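(* Let $\mathcal{A}\in\mathbb{R}_+^{[m,n]}$ be a nonnegative tensor of order $m\ge 2$ and dimension $n$, and let $(\mathbf{x}_*,\lambda_* )$ be a nonnegative eigenpair of $\mathcal{A}$, i.e. $\mathbf{x}_*\in\mathbb{R}^n$, $\mathbf{x}_*\ge 0$, $\|\mathbf{x}_*\|_1=1$, $\lambda_*\in\mathbb{R}$ and $\mathcal{A}\mathbf{x}_*^{m-1}=\lambda_*\mathbf{x}_*$. Assume that the $(n+1)\times(n+1)$ Jacobian matrix $$\mathbf{Jf}(\mathbf{x}_*,\lambda_* )=\begin{bmatrix}\lambda_* I-T(\mathbf{x}_* ) & \mathbf{x}_*\\ \mathbf{e}^T & 0\end{bmatrix}$$ is nonsingular. Then for every sequence $\{(\mathbf{x}_k,\lambda_k)\}_{k\ge 0}$ generated by the modified projected Newton iteration (MPNI, defined in the context) applied to $\mathcal{A}$, if $(\mathbf{x}_{k_0},\lambda_{k_0})$ is sufficiently close to $(\mathbf{x}_*,\lambda_* )$ for some $k_0\ge 0$, then $(\mathbf{x}_k,\lambda_k)$ converges to $(\mathbf{x}_*,\lambda_* )$ quadratically. Explicitly: there exist constants $\delta>0$ and $c>0$ (depending only on $\mathcal{A}$ and $(\mathbf{x}_*,\lambda_* )$) such that, for every MPNI sequence $\{(\mathbf{x}_k,\lambda_k)\}_{k\ge0}$ and every $k_0\ge 0$ with $\left\|\begin{bmatrix}\mathbf{x}_{k_0}\\ \lambda_{k_0}\end{bmatrix}-\begin{bmatrix}\mathbf{x}_{*}\\ \lambda_{*}\end{bmatrix}\right\|_1<\delta$,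 one has $(\mathbf{x}_k,\lambda_k)\to(\mathbf{x}_*,\lambda_* )$ as $k\to\infty$ and $$\left\|\begin{bmatrix}\mathbf{x}_{k+1}\\ \lambda_{k+1}\end{bmatrix}-\begin{bmatrix}\mathbf{x}_{*}\\ \lambda_{*}\end{bmatrix}\right\|_1\le c\left\|\begin{bmatrix}\mathbf{x}_{k}\\ \lambda_{k}\end{bmatrix}-\begin{bmatrix}\mathbf{x}_{*}\\ \lambda_{*}\end{bmatrix}\right\|_1^2\qquad\text{for all } k\ge k_0 .$$
   Context: Tensors. $\mathbb{R}^{[m,n]}$ is the set of real $m$th-order $n$-dimensional tensors $\mathcal{A}=(A_{i_1i_2\ldots i_m})$, $1\le i_1,\ldots,i_m\le n$, and $\mathbb{R}_+^{[m,n]}$ is the subset of those with all entries $A_{i_1\ldots i_m}\ge 0$. No symmetry is assumed. For $\mathbf{x}\in\mathbb{R}^n$, $\mathcal{A}\mathbf{x}^{m-1}\in\mathbb{R}^n$ is the vector with entries $$(\mathcal{A}\mathbf{x}^{m-1})_i=\sum_{i_2,\ldots,i_m=1}^n A_{ii_2\ldots i_m}x_{i_2}\cdots x_{i_m}.$$ $T(\mathbf{x})$ is the $n\times n$ matrix with entries $T(\mathbf{x})_{ij}=\frac{\partial}{\partial x_j}\left(\mathcal{A}\mathbf{x}^{m-1}\right)_i$. Let $\mathbf{e}=[1,\ldots,1]^T\in\mathbb{R}^n$. Vector inequalities and the maximum $\max(\mathbf{x},\mathbf{0})$ are elementwise; $\|\cdot\|_1$ is the 1-norm. An eigenpair here means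 a $Z_1$-eigenpair: $(\mathbf{x},\lambda)\in(\mathbb{R}^n\setminus\{0\})\times\mathbb{R}$ with $\mathcal{A}\mathbf{x}^{m-1}=\lambda\mathbf{x}$ and $\|\mathbf{x}\|_1=1$. The matrix $\mathbf{Jf}(\mathbf{x},\lambda)=\begin{bmatrix}\lambda I-T(\mathbf{x}) & \mathbf{x}\\ \mathbf{e}^T & 0\end{bmatrix}$ is the Jacobian of the map $\mathbf{f}(\mathbf{x},\lambda)=\begin{bmatrix}\lambda\mathbf{x}-\mathcal{A}\mathbf{x}^{m-1}\\ \mathbf{e}^T\mathbf{x}-1\end{bmatrix}$. Projection. For a vector $\mathbf{x}\in\mathbb{R}^n$ with at least one positive component, $\mathsf{proj}(\mathbf{x})=\dfrac{\max(\mathbf{x},\mathbf{0})}{\|\max(\mathbf{x},\mathbf{0})\|_1}$. Modified projected Newton iteration (MPNI). Start from $\mathbf{x}_0>0$ with $\|\mathbf{x}_0\|_1=1$ and $\lambda_0=\max_{i}\dfrac{(\mathcal{A}\mathbf{x}_0^{m-1})_i}{(\mathbf{x}_0)_i}$. For $k=0,1,2,\ldots$ (the sequence is considered as infinite, i.e. the numerical stopping test is ignored): 1. Solve the linear system $$\begin{bmatrix}\lambda_k I-T(\mathbf{x}_k) & \mathbf{x}_k\\ \mathbf{e}^T & 0\end{bmatrix}\begin{bmatrix}\mathbf{d}_k\\ \delta_k\end{bmatrix}=\begin{bmatrix}\lambda_k\mathbf{x}_k-\mathcal{A}\mathbf{x}_k^{m-1}\\ \mathbf{e}^T\mathbf{x}_k-1\end{bmatrix}$$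 and set $\widehat{\mathbf{x}}_{k+1}=\mathbf{x}_k-\mathbf{d}_k$, $\widehat{\lambda}_{k+1}=\lambda_k-\delta_k$ (one Newton step for $\mathbf{f}=0$). 2. Set $\mathbf{x}_{k+1}=\mathsf{proj}(\widehat{\mathbf{x}}_{k+1})$. 3. Set $\lambda_{k+1}=\max(\widehat{\lambda}_{k+1},0)$. The algorithm requires the coefficient matrix $\mathbf{Jf}(\mathbf{x}_k,\lambda_k)$ in step 1 to be nonsingular; if it is singular for some $k$, then before step 1 the value $\lambda_k$ is replaced by $\lambda_k+\epsilon_k$ with some small $\epsilon_k>0$ for which the matrix becomes nonsingular (the replaced value is then the one called $\lambda_k$). *)

(* Defs.v *)
From HB Require Import structures.
From mathcomp Require Import all_boot all_order all_algebra.
From mathcomp Require Import all_classical all_reals all_analysis.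
Set Implicit Arguments.
Unset Strict Implicit.
Unset Printing Implicit Defensive.
Import Order.TTheory GRing.Theory Num.Theory.
Import numFieldNormedType.Exports.
Local Open Scope classical_set_scope.
Local Open Scope ring_scope.

Definition tensor (R : Type) (m n : nat) := m.-tuple 'I_n -> R.

Definition nonneg_tensor (R : realType) (m n : nat) (A : tensor R m n) : Prop :=
  forall t, 0 <= A t.

(* The vector A x^(m-1): entry i sums over the index tuples (i, i_2, ..., i_m)
   whose first index is i. *)
Definition tapply (R : realType) (m n : nat) (A : tensor R m n)
    (x : 'cV[R]_n) : 'cV[R]_n :=
  \col_i \sum_(t : m.-tuple 'I_n | ohead t == Some i)
            A t * \prod_(j <- behead t) x j 0.

Definition Tmx (R : realType) (m n : nat) (A : tensor R m n)
    (x : 'cV[R]_n) : 'M[R]_n :=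
  \matrix_(i, j) 'D_(delta_mx j 0) (fun y : 'cV[R]_n => tapply A y i 0) x.

Definition ones (R : realType) (n : nat) : 'cV[R]_n := const_mx 1.

Definition l1norm (R : realType) (n : nat) (x : 'cV[R]_n) : R :=
  \sum_i `|x i 0|.

Definition Z1_eigenpair (R : realType) (m n : nat) (A : tensor R m n)
    (x : 'cV[R]_n) (lam : R) : Prop :=
  [/\ x != 0, tapply A x = lam *: x & l1norm x = 1].

Definition stack (R : realType) (n : nat) (x : 'cV[R]_n) (lam : R) :
    'cV[R]_(n + 1) := col_mx x lam%:M.

Definition newton_map (R : realType) (m n : nat) (A : tensor R m n)
    (x : 'cV[R]_n) (lam : R) : 'cV[R]_(n + 1) :=
  col_mx (lam *: x - tapply A x) ((ones R n)^T *m x - 1%:M).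

Definition Jf (R : realType) (m n : nat) (A : tensor R m n)
    (x : 'cV[R]_n) (lam : R) : 'M[R]_(n + 1) :=
  block_mx (lam%:M - Tmx A x) x (ones R n)^T 0.

Definition pos_part (R : realType) (n : nat) (x : 'cV[R]_n) : 'cV[R]_n :=
  \col_i Num.max (x i 0) 0.

(* Meaningful when x has a positive entry. In the iteration below the last row
   of the Newton system forces the entries of the projected vector to sum to 1,
   so this is always the case. *)
Definition simplex_proj (R : realType) (n : nat) (x : 'cV[R]_n) : 'cV[R]_n :=
  (l1norm (pos_part x))^-1 *: pos_part x.

(* max_i (A x^(m-1))_i / x_i. The default value 0 of the iterated maximum does
   not alter it, the ratios being nonnegative for A >= 0 and x > 0. *)
Definition max_ratio (R : realType) (m n : nat) (A : tensor R m n)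
    (x : 'cV[R]_n) : R :=
  \big[Num.max/0]_(i < n) (tapply A x i 0 / x i 0).

(* Passage from the computed value mu of the multiplier to the value lam that
   is actually used: mu is kept when the Jacobian is nonsingular, and otherwise
   increased by some eps > 0 making it nonsingular. *)
Definition regularized (R : realType) (m n : nat) (A : tensor R m n)
    (x : 'cV[R]_n) (mu lam : R) : Prop :=
  if Jf A x mu \in unitmx then lam = mu
  else exists eps : R, [/\ 0 < eps, lam = mu + eps & Jf A x lam \in unitmx].

Definition mpni_step (R : realType) (m n : nat) (A : tensor R m n)
    (x : 'cV[R]_n) (lam : R) (x' : 'cV[R]_n) (mu' : R) : Prop :=
  exists (d : 'cV[R]_n) (delta : R),
    [/\ Jf A x lam *m stack d delta = newton_map A x lam,
        x' = simplex_proj (x - d) &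
        mu' = Num.max (lam - delta) 0].

(* (x k, lam k) is a sequence generated by the iteration; mu k is the value of
   the multiplier before the possible replacement at step k. *)
Definition mpni (R : realType) (m n : nat) (A : tensor R m n)
    (x : nat -> 'cV[R]_n) (lam : nat -> R) : Prop :=
  exists mu : nat -> R,
    [/\ (forall i, 0 < x 0%N i 0) /\ l1norm (x 0%N) = 1,
        mu 0%N = max_ratio A (x 0%N),
        (forall k, regularized A (x k) (mu k) (lam k)) &
        (forall k, mpni_step A (x k) (lam k) (x k.+1) (mu k.+1))].

(* Main.v *)
(* Write z = (x, lambda), z* for the eigenpair and zhat for the Newton iterate
   from z. The vector Jf(z) (zhat - z* ) is the first-order Taylor remainder of
   the polynomial map f at z, hence is O(|z - z*|^2). Since Jf is Lipschitz near
   z* and Jf(z* ) is invertible, |w| <= K |Jf(z) w| for z near z*; this yields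
   |zhat - z*| = O(|z - z*|^2), and also that Jf(z) is nonsingular there, so that
   the multiplier is never modified near z*. Finally the last equation of
   the Newton system makes the entries of xhat sum to 1, so the 1-norm of its
   positive part is at least 1 and the projection at most doubles the distance
   to x*. *)
Require Import Defs.
From mathcomp Require Import all_boot all_order all_algebra.
From mathcomp Require Import all_classical all_reals all_analysis.
From mathcomp Require Import ring lra.
Import Order.TTheory GRing.Theory Num.Theory.
Import numFieldNormedType.Exports.
Local Open Scope classical_set_scope.
Local Open Scope ring_scope.

Set Implicit Arguments.
Unset Strict Implicit.
Unset Printing Implicit Defensive.

(** * The 1-norm on column vectors, lower bounds for invertible matrices, and the simplex
    projection *)

Section L1norm.
Context {R : realType}.

Lemma l1norm_ge0 n (x : 'cV[R]_n) : 0 <= l1norm x.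
Proof. exact: sumr_ge0. Qed.

Lemma l1normN n (x : 'cV[R]_n) : l1norm (- x) = l1norm x.
Proof. by apply: eq_bigr => i _; rewrite mxE normrN. Qed.

Lemma l1norm_distrC n (x y : 'cV[R]_n) : l1norm (x - y) = l1norm (y - x).
Proof. by rewrite -l1normN opprB. Qed.

Lemma l1normZ n (a : R) (x : 'cV[R]_n) : l1norm (a *: x) = `|a| * l1norm x.
Proof. by rewrite /l1norm mulr_sumr; apply: eq_bigr => i _; rewrite mxE normrM. Qed.

Lemma l1normD n (x y : 'cV[R]_n) : l1norm (x + y) <= l1norm x + l1norm y.
Proof. by rewrite /l1norm -big_split; apply: ler_sum => i _; rewrite mxE ler_normD. Qed.

Lemma ler_coord_l1norm n (x : 'cV[R]_n) i : `|x i 0| <= l1norm x.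
Proof. by rewrite /l1norm (bigD1 i) //= lerDl sumr_ge0. Qed.

Lemma l1norm_eq0 n (x : 'cV[R]_n) : l1norm x <= 0 -> x = 0.
Proof.
move=> x0; apply/colP => i; rewrite mxE; apply/normr0_eq0/le_anti.
by rewrite normr_ge0 (le_trans (ler_coord_l1norm x i)).
Qed.

Lemma l1norm_col_mx n p (x : 'cV[R]_n) (y : 'cV[R]_p) :
  l1norm (col_mx x y) = l1norm x + l1norm y.
Proof.
rewrite /l1norm big_split_ord /=; congr (_ + _); apply: eq_bigr => i _.
  by rewrite col_mxEu.
by rewrite col_mxEd.
Qed.

Lemma l1norm_scalar (a : R) : l1norm (a%:M : 'cV[R]_1) = `|a|.
Proof. by rewrite /l1norm big_ord1 mxE eqxx mulr1n. Qed.

Lemma l1norm_delta n (j : 'I_n) : l1norm (delta_mx j 0 : 'cV[R]_n) = 1.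
Proof.
rewrite /l1norm (bigD1 j) //= big1 ?addr0; first by rewrite mxE !eqxx normr1.
by move=> i /negPf ij; rewrite mxE ij normr0.
Qed.

Lemma ler_norm_mulmx_row n (C : R) (r : 'rV[R]_n) (d : 'cV[R]_n) :
  (forall j, `|r 0 j| <= C) -> `|(r *m d) 0 0| <= C * l1norm d.
Proof.
move=> rC; rewrite mxE mulr_sumr (le_trans (ler_norm_sum _ _ _)) //.
by apply: ler_sum => j _; rewrite normrM ler_wpM2r.
Qed.

Lemma ler_l1norm_mulmx n p (C : R) (M : 'M[R]_(p, n)) (d : 'cV[R]_n) :
  (forall i j, `|M i j| <= C) -> l1norm (M *m d) <= p%:R * C * l1norm d.
Proof.
move=> MC; rewrite -mulrA mulr_natl -[p in leRHS]card_ord -sumr_const.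
apply: ler_sum => i _.
suff -> : (M *m d) i 0 = (row i M *m d) 0 0.
  by apply: ler_norm_mulmx_row => j; rewrite mxE.
by rewrite -row_mul [RHS]mxE.
Qed.

(** The bound forces a trivial kernel. [inj_row_free] concerns row vectors, hence the passage to the
    transpose. *)
Lemma mulmx_lbound_unit n (K : R) (M : 'M[R]_n) :
  (forall w, l1norm w <= K * l1norm (M *m w)) -> M \in unitmx.
Proof.
move=> MK; rewrite -unitmx_tr -row_free_unit; apply: inj_row_free => v vM.
have Mv : M *m v^T = 0 by rewrite -[M]trmxK -trmx_mul vM trmx0.
apply: trmx_inj; rewrite trmx0; apply: l1norm_eq0.
by have := MK v^T; rewrite Mv (_ : l1norm 0 = 0) ?mulr0 // /l1norm big1 // => i _;
  rewrite mxE normr0.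
Qed.

Lemma unitmx_lbound n (M : 'M[R]_n) : M \in unitmx ->
  exists2 K : R, 0 < K & forall w, l1norm w <= K * l1norm (M *m w).
Proof.
move=> Mu; set C := \sum_i \sum_j `|invmx M i j|.
have C0 : 0 <= C by do 2!apply: sumr_ge0 => ? _.
(* [C] dominates every entry of the inverse, so [n%:R * C] already works in w = M^-1 (M w); the
   added 1 ensures strict positivity. *)
exists (n%:R * C + 1); first by rewrite ltr_wpDl// mulr_ge0.
move=> w; rewrite -{1}[w](mulKmx Mu).
apply: le_trans (_ : n%:R * C * l1norm (M *m w) <= _).
  apply: ler_l1norm_mulmx => i j.
  rewrite /C (bigD1 i) //= (bigD1 j) //= -addrA lerDl addr_ge0 //.
    exact: sumr_ge0.
  by do 2!apply: sumr_ge0 => ? _.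
by rewrite mulrDl mul1r lerDl l1norm_ge0.
Qed.

(** Balls of matrices are entrywise, and each entry is dominated by the 1-norm. *)
Lemma cvg_l1norm n (u : nat -> 'cV[R]_n) (l : 'cV[R]_n) :
  (l1norm (u k - l) @[k --> \oo] --> 0) -> u @ \oo --> l.
Proof.
move=> ul; apply/cvg_ballP => e e0.
move/cvgr0Pnorm_lt : ul => /(_ e e0); apply: filterS => k ke.
split=> // i j; rewrite ord1 /ball /= distrC.
apply: le_lt_trans ke; rewrite [leRHS]ger0_norm ?l1norm_ge0 //.
by have := ler_coord_l1norm (u k - l) i; rewrite !mxE.
Qed.

(** Clipping a negative entry at 0 moves it towards the nonnegative entry of [y]. *)
Lemma l1norm_pos_part n (x y : 'cV[R]_n) : (forall i, 0 <= y i 0) ->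
  l1norm (pos_part x - y) <= l1norm (x - y).
Proof.
move=> y0; apply: ler_sum => i _; rewrite !mxE.
have [x0|x0] := leP 0 (x i 0) => //.
have := y0 i => yi; rewrite sub0r normrN ger0_norm // ler0_norm; lra.
Qed.

(** Let p be the positive part and s its 1-norm. Since s >= 1, rescaling moves p by exactly s - 1 =
    |p| - |y| <= |p - y|. Clipping and rescaling thus each cost at most |x - y|. *)
Lemma l1norm_simplex_proj n (x y : 'cV[R]_n) : (forall i, 0 <= y i 0) ->
  l1norm y = 1 -> \sum_i x i 0 = 1 ->
  l1norm (simplex_proj x - y) <= 2 * l1norm (x - y).
Proof.
move=> y0 y1 x1; have px := l1norm_pos_part x y0.
rewrite /simplex_proj; set p := pos_part x in px *; set s := l1norm p.
have s1 : 1 <= s.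
  rewrite -x1; apply: ler_sum => i _; rewrite mxE.
  by rewrite (le_trans _ (ler_norm _)) // le_max lexx.
have s0 : 0 < s by lra.
have sb : s - 1 <= l1norm (p - y).
  by rewrite lerBlDr -y1; apply: le_trans (l1normD _ _); rewrite subrK.
have -> : s^-1 *: p - y = (s^-1 - 1) *: p + (p - y).
  by rewrite scalerBl scale1r addrA subrK.
apply: le_trans (l1normD _ _) _; rewrite l1normZ -/s.
suff -> : `|s^-1 - 1| * s = s - 1 by lra.
have : s^-1 <= 1 by rewrite invf_le1.
move=> ?; rewrite ler0_norm ?subr_le0 //; field; lra.
Qed.

End L1norm.

(** * First-order Taylor estimates, uniform on 1-norm balls, for polynomial functions *)

Section Taylor.
Context {R : realType} {n : nat}.
Implicit Types (g h : 'cV[R]_n -> R) (dg dh : 'cV[R]_n -> 'rV[R]_n).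

(** [dg] is a candidate gradient, written as a row. The size and Lipschitz bounds accompany the
    remainder bound so that the whole package is stable under products. *)
Definition taylor_bound (B C : R) g dg :=
  forall x y, l1norm x <= B -> l1norm y <= B ->
  [/\ `|g x| <= C, forall j, `|dg x 0 j| <= C,
      `|g y - g x| <= C * l1norm (y - x),
      forall j, `|dg y 0 j - dg x 0 j| <= C * l1norm (y - x) &
      `|g y - g x - (dg x *m (y - x)) 0 0| <= C * l1norm (y - x) ^+ 2].

Definition taylor g dg := forall B, exists2 C, 0 <= C & taylor_bound B C g dg.

Lemma taylor_boundW B C D g dg : C <= D ->
  taylor_bound B C g dg -> taylor_bound B D g dg.
Proof.
move=> CD gC x y xB yB; have [h1 h2 h3 h4 h5] := gC x y xB yB.
split=> [|j||j|]; try exact: le_trans CD.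
- by apply: le_trans h3 _; rewrite ler_wpM2r ?l1norm_ge0.
- by apply: le_trans (h4 j) _; rewrite ler_wpM2r ?l1norm_ge0.
- by apply: le_trans h5 _; rewrite ler_wpM2r ?exprn_ge0 ?l1norm_ge0.
Qed.

Lemma taylor_common g h dg dh : taylor g dg -> taylor h dh -> forall B,
  exists C, [/\ 0 <= C, taylor_bound B C g dg & taylor_bound B C h dh].
Proof.
move=> tg th B; have [C C0 gC] := tg B; have [D D0 hD] := th B.
exists (C + D); split; first exact: addr_ge0.
  by apply: taylor_boundW gC; rewrite lerDl.
by apply: taylor_boundW hD; rewrite lerDr.
Qed.

Lemma taylor_cst (a : R) : taylor (fun=> a) (fun=> 0).
Proof.
move=> B; exists `|a| => // x y _ _; split=> [|j||j|] //.
- by rewrite mxE normr0.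
- by rewrite subrr normr0 mulr_ge0 ?l1norm_ge0.
- by rewrite !mxE subrr normr0 mulr_ge0 ?l1norm_ge0.
- by rewrite mul0mx mxE subrr subr0 normr0 mulr_ge0 ?exprn_ge0 ?l1norm_ge0.
Qed.

Lemma taylor_coord (i : 'I_n) : taylor (fun x => x i 0) (fun=> delta_mx 0 i).
Proof.
move=> B; exists (`|B| + 1); first exact: addr_ge0.
move=> x y xB yB; have C0 : 0 <= `|B| + 1 by exact: addr_ge0.
have B1 := ler_norm B; split=> [|j||j|].
- by apply: le_trans (ler_coord_l1norm _ _) _; lra.
- by rewrite !mxE eqxx /=; case: eqP => _ /=; rewrite ?normr1 ?normr0; have := normr_ge0 B; lra.
- have := ler_coord_l1norm (y - x) i; rewrite !mxE => yx.
  by apply: le_trans yx _; rewrite ler_peMl ?l1norm_ge0 // lerDr.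
- by rewrite subrr normr0 mulr_ge0 ?l1norm_ge0.
- rewrite -rowE !mxE subrr normr0 mulr_ge0 ?exprn_ge0 ?l1norm_ge0 //.
Qed.

Lemma taylorD g h dg dh : taylor g dg -> taylor h dh ->
  taylor (fun x => g x + h x) (fun x => dg x + dh x).
Proof.
move=> tg th B; have [C [C0 gC hC]] := taylor_common tg th B.
exists (C + C); first exact: addr_ge0.
move=> x y xB yB; have [g1 g2 g3 g4 g5] := gC x y xB yB.
have [h1 h2 h3 h4 h5] := hC x y xB yB.
have leD (a b s t : R) : `|a| <= s -> `|b| <= t -> `|a + b| <= s + t.
  by move=> ? ?; exact: le_trans (ler_normD _ _) (lerD _ _).
split=> [|j||j|]; rewrite ?mulrDl.
- exact: leD.
- by rewrite mxE; exact: leD.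
- by rewrite opprD addrACA; exact: leD.
- by rewrite [(dg x + _) _ _]mxE [(dg y + _) _ _]mxE opprD addrACA; exact: leD.
- rewrite mulmxDl [(dg x *m _ + _) _ _]mxE.
  rewrite (_ : _ - _ - _ = (g y - g x - (dg x *m (y - x)) 0 0)
                         + (h y - h x - (dh x *m (y - x)) 0 0)); last by ring.
  exact: leD.
Qed.

Lemma taylorM g h dg dh : taylor g dg -> taylor h dh ->
  taylor (fun x => g x * h x) (fun x => g x *: dh x + h x *: dg x).
Proof.
move=> tg th B; have [C [C0 gC hC]] := taylor_common tg th B.
have CC0 : 0 <= C * C by exact: mulr_ge0.
(* The gradient's Lipschitz estimate splits into four products, each at most [C * C] times the
   distance; the other estimates produce at most three. *)
exists (4 * (C * C)); first lra.
move=> x y xB yB; have [g1 g2 g3 g4 g5] := gC x y xB yB.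
have [h1 h2 h3 h4 h5] := hC x y xB yB.
have [gy _ _ _ _] := gC y x yB xB; have [hy _ _ _ _] := hC y x yB xB.
set D := l1norm (y - x) in g3 g4 g5 h3 h4 h5 *.
have D0 : 0 <= D by exact: l1norm_ge0.
have CCD : 0 <= C * C * D by exact: mulr_ge0.
have CCD2 : 0 <= C * C * D ^+ 2 by rewrite mulr_ge0 ?exprn_ge0.
have leM (a b s t : R) : `|a| <= s -> `|b| <= t -> `|a * b| <= s * t.
  by move=> ? ?; rewrite normrM ler_pM.
split=> [|j||j|].
- by have := leM _ _ _ _ g1 h1; lra.
- rewrite !mxE; apply: le_trans (ler_normD _ _) _.
  by have := leM _ _ _ _ g1 (h2 j); have := leM _ _ _ _ h1 (g2 j); lra.
- rewrite (_ : _ - _ = g y * (h y - h x) + h x * (g y - g x)); last by ring.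
  apply: le_trans (ler_normD _ _) _.
  by have := leM _ _ _ _ gy h3; have := leM _ _ _ _ h1 g3; lra.
- rewrite !mxE (_ : _ - _ = g y * (dh y 0 j - dh x 0 j) + (g y - g x) * dh x 0 j
     + h y * (dg y 0 j - dg x 0 j) + (h y - h x) * dg x 0 j); last by ring.
  apply: le_trans (ler_normD _ _) _; apply: le_trans (lerD (ler_normD _ _) (lexx _)) _.
  apply: le_trans (lerD (lerD (ler_normD _ _) (lexx _)) (lexx _)) _.
  have := leM _ _ _ _ gy (h4 j); have := leM _ _ _ _ g3 (h2 j).
  by have := leM _ _ _ _ hy (g4 j); have := leM _ _ _ _ h3 (g2 j); lra.
- rewrite mulmxDl -!scalemxAl [X in `|_ - X|]mxE [X in `|_ - (X + _)|]mxE
    [X in `|_ - (_ + X)|]mxE.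
  set u := (dg x *m _) 0 0 in g5 *; set v := (dh x *m _) 0 0 in h5 *.
  rewrite (_ : _ - _ = g x * (h y - h x - v) + h x * (g y - g x - u)
     + (g y - g x) * (h y - h x)); last by ring.
  apply: le_trans (ler_normD _ _) _; apply: le_trans (lerD (ler_normD _ _) (lexx _)) _.
  have := leM _ _ _ _ g1 h5; have := leM _ _ _ _ h1 g5.
  by have := leM _ _ _ _ g3 h3; lra.
Qed.

(** By the quadratic remainder, the difference quotient with increment h differs from [dg x 0 j] by
    at most C |h|. *)
Lemma taylor_derive g dg (x : 'cV[R]_n) (j : 'I_n) : taylor g dg ->
  'D_(delta_mx j 0) g x = dg x 0 j.
Proof.
(* This radius contains every increment with |h| <= 1. *)
move=> tg; have [C C0 gC] := tg (l1norm x + 1).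
apply: cvg_lim => //; apply/cvgrPdist_le => e e0.
have C1 : 0 < C + 1 by lra.
near=> h; have h1 : `|h| <= 1 by near: h; apply: dnbhs0_le.
have he : `|h| <= e / (C + 1) by near: h; apply: dnbhs0_le; exact: divr_gt0.
have h0 : h != 0 by near: h; exact: nbhs_dnbhs_neq.
have nh : l1norm (h *: (delta_mx j 0 : 'cV[R]_n)) = `|h|.
  by rewrite l1normZ l1norm_delta mulr1.
have xB : l1norm x <= l1norm x + 1 by rewrite lerDl.
have yB : l1norm (h *: delta_mx j 0 + x) <= l1norm x + 1.
  by rewrite addrC (le_trans (l1normD _ _)) // lerD2l nh.
have [_ _ _ _] := gC _ _ xB yB.
rewrite addrK nh -scalemxAr -colE !mxE /= => H.
rewrite distrC /= (_ : _ - _ = h^-1 * (g (h *: delta_mx j 0 + x) - g x - h * dg x 0 j)).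
  rewrite normrM normfV mulrC ler_pdivrMr ?normr_gt0 //.
  apply: le_trans H _; rewrite expr2 mulrA ler_wpM2r //.
  move: he; rewrite ler_pdivlMr // => he; have := normr_ge0 h; lra.
by rewrite /GRing.scale /= [RHS]mulrBr mulKf.
Unshelve. all: by end_near. Qed.

Lemma eq_taylor g h dg : g =1 h -> taylor g dg -> taylor h dg.
Proof. by move=> /funext ->. Qed.

Lemma taylor_prod (s : seq 'I_n) :
  exists dg, taylor (fun x => \prod_(j <- s) x j 0) dg.
Proof.
elim: s => [|i s [dg IH]]; eexists.
  by apply: eq_taylor (taylor_cst 1) => x; rewrite big_nil.
by apply: eq_taylor (taylorM (taylor_coord i) IH) => x; rewrite big_cons.
Qed.

Lemma taylor_sum (I : Type) (r : seq I) (P : pred I) (F : I -> 'cV[R]_n -> R) :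
  (forall i, exists dg, taylor (F i) dg) ->
  exists dg, taylor (fun x => \sum_(i <- r | P i) F i x) dg.
Proof.
move=> tF; elim: r => [|i r [dg IH]].
  by eexists; apply: eq_taylor (taylor_cst 0) => x; rewrite big_nil.
have [Pi|Pi] := boolP (P i); last first.
  by exists dg; apply: eq_taylor IH => x; rewrite big_cons (negPf Pi).
have [dF ti] := tF i; eexists.
by apply: eq_taylor (taylorD ti IH) => x; rewrite big_cons Pi.
Qed.

(** Sums and products of coordinates provide some gradient; [taylor_derive] identifies it with a row
    of [Tmx], so its formula is never computed. *)
Lemma taylor_tapply m (A : tensor R m n) (i : 'I_n) :
  taylor (fun x => tapply A x i 0) (fun x => row i (Tmx A x)).
Proof.
suff [dg tg] : exists dg, taylor (fun x => tapply A x i 0) dg.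
  rewrite (_ : (fun x => row i _) = dg) //; apply/funext => x; apply/rowP => j.
  by rewrite !mxE (taylor_derive _ _ tg).
suff [dg tg] : exists dg, taylor (fun x => \sum_(t : m.-tuple 'I_n | ohead t == Some i)
    A t * \prod_(j <- behead t) x j 0) dg.
  by exists dg; apply: eq_taylor tg => x; rewrite mxE.
apply: taylor_sum => t; have [dg tg] := taylor_prod (behead t).
by eexists; apply: taylorM (taylor_cst (A t)) tg.
Qed.

End Taylor.

(** Summing the entrywise constants gives one constant for the 1-norm. The first estimate serves the
    Newton residual, the second the perturbation of the Jacobian. *)
Lemma tapply_taylor (R : realType) m n (A : tensor R m n) (B : R) :
  exists2 C, 0 <= C & forall x y, l1norm x <= B -> l1norm y <= B ->
    l1norm (tapply A y - tapply A x - Tmx A x *m (y - x)) <= C * l1norm (y - x) ^+ 2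
    /\ forall u, l1norm ((Tmx A y - Tmx A x) *m u) <= C * l1norm (y - x) * l1norm u.
Proof.
have /choice[C CP] : forall i, exists C, 0 <= C /\ taylor_bound B C
    (fun x => tapply A x i 0) (fun x => row i (Tmx A x)).
  by move=> i; have [C ? ?] := taylor_tapply A i B; exists C.
have C0 i : 0 <= C i by case: (CP i).
exists (\sum_i C i); first exact: sumr_ge0.
move=> x y xB yB; split=> [|u].
  rewrite mulr_suml; apply: ler_sum => i _.
  have [_ /(_ x y xB yB) [_ _ _ _]] := CP i.
  by rewrite -row_mul !mxE.
rewrite -mulrA mulr_suml; apply: ler_sum => i _; rewrite mulrA.
rewrite (_ : (_ *m u) i 0 = (row i (Tmx A y - Tmx A x) *m u) 0 0); last first.
  by rewrite -row_mul [RHS]mxE.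
apply: ler_norm_mulmx_row => j.
by have [_ /(_ x y xB yB) [_ _ _ /(_ j)]] := CP i; rewrite !mxE.
Qed.

(** * One iteration near the eigenpair *)

Section Newton.
Context {R : realType} {m n : nat}.
Variables (A : tensor R m n) (xs : 'cV[R]_n) (ls : R).
Hypotheses (heig : Z1_eigenpair A xs ls) (hJ : Jf A xs ls \in unitmx).
Hypothesis hxs : forall i, 0 <= xs i 0.

Let err (x : 'cV[R]_n) (lam : R) := l1norm (stack x lam - stack xs ls).

Lemma l1norm_stackB (x y : 'cV[R]_n) (a b : R) :
  l1norm (stack x a - stack y b) = l1norm (x - y) + `|a - b|.
Proof.
by rewrite /stack opp_col_mx add_col_mx l1norm_col_mx -raddfB l1norm_scalar.
Qed.

Lemma Jf_stack (x u : 'cV[R]_n) (lam v : R) :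
  Jf A x lam *m stack u v =
  col_mx (lam *: u - Tmx A x *m u + v *: x) ((ones R n)^T *m u).
Proof.
rewrite /Jf /stack mul_block_col mulmxBl mul_scalar_mx mul0mx addr0.
by rewrite mul_mx_scalar.
Qed.

(* The Jacobian at a nearby point is a small perturbation of the invertible
   one at the eigenpair. *)
Lemma Jf_lbound : exists d K : R, [/\ 0 < d, 0 < K & forall x lam, err x lam < d ->
  forall w, l1norm w <= K * l1norm (Jf A x lam *m w)].
Proof.
have [K K0 KP] := unitmx_lbound hJ.
have [C C0 CP] := tapply_taylor A 2.
have [_ _ xs1] := heig.
(* Distance below 1 keeps [x] in the ball of radius 2, as [xs] has norm 1. The other bound makes [K]
   times the perturbation at most half of |w|; absorbing that half turns [K] into [2 * K]. *)
pose d := Num.min 1 (2 * K * (C + 1))^-1.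
have D0 : 0 < 2 * K * (C + 1) by rewrite !mulr_gt0 //; lra.
exists d, (2 * K); split; [|lra|].
  by rewrite lt_min ltr01 invr_gt0 D0.
move=> x lam; rewrite lt_min => /andP[E1 Ed] w.
have EP : err x lam = l1norm (x - xs) + `|lam - ls| by exact: l1norm_stackB.
have ll := normr_ge0 (lam - ls); have lx := l1norm_ge0 (x - xs).
have x2 : l1norm x <= 2.
  by rewrite -(subrK xs x); apply: le_trans (l1normD _ _) _; lra.
have xs2 : l1norm xs <= 2 by lra.
have [_ TP] := CP _ _ xs2 x2.
have [u [v ->]] : exists u v, w = stack u v.
  by exists (usubmx w), (dsubmx w 0 0); rewrite /stack -mx11_scalar vsubmxK.
set W := l1norm (stack u v).
have WP : W = l1norm u + `|v| by rewrite /W l1norm_col_mx l1norm_scalar.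
have uw := l1norm_ge0 u; have vw := normr_ge0 v.
have pert : l1norm (Jf A xs ls *m stack u v - Jf A x lam *m stack u v)
            <= (C + 1) * err x lam * W.
  (* Both Jacobians have the same last row, so only the top block contributes. *)
  rewrite !Jf_stack opp_col_mx add_col_mx l1norm_col_mx subrr.
  rewrite [l1norm 0]big1 ?addr0; last by move=> i _; rewrite mxE normr0.
  rewrite (_ : _ - _ = (ls - lam) *: u + (Tmx A x - Tmx A xs) *m u + v *: (xs - x)).
    apply: le_trans (l1normD _ _) _.
    apply: le_trans (lerD (l1normD _ _) (lexx _)) _.
    rewrite !l1normZ distrC [l1norm (xs - x)]l1norm_distrC.
    have := TP u; rewrite EP WP; set a := l1norm (x - xs) in lx *.
    set b := `|lam - ls| in ll *.
    have := mulr_ge0 C0 (mulr_ge0 lx vw); have := mulr_ge0 C0 (mulr_ge0 ll vw).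
    have := mulr_ge0 C0 (mulr_ge0 ll uw); have := mulr_ge0 lx uw.
    have := mulr_ge0 ll vw; lra.
  rewrite mulmxBl scalerBl scalerBr; apply/colP => i; rewrite !mxE; ring.
have := KP (stack u v); rewrite -/W.
set J := Jf A x lam *m stack u v in pert *; set Js := Jf A xs ls *m stack u v in pert *.
have Jsb : l1norm Js <= l1norm (Js - J) + l1norm J.
  by rewrite -{1}(subrK J Js) l1normD.
have small : K * ((C + 1) * err x lam * W) <= 2^-1 * W.
  rewrite mulrA ler_wpM2r; [by []|lra|].
  move: Ed; rewrite -div1r ltr_pdivlMr // => Ed; lra.
move=> H; have : K * l1norm Js <= K * ((C + 1) * err x lam * W + l1norm J).
  by rewrite ler_pM2l //; lra.
lra.
Qed.

(** The step equation rewrites the vector as [Jf] applied to the current error, minus [newton_map].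
    Its top block is the Taylor remainder of [tapply] plus [(lam - ls) *: (x - xs)], coming from the
    bilinear term; the affine constraint leaves nothing. *)
Lemma newton_residual : exists2 C : R, 0 <= C & forall x lam d delta,
  err x lam < 1 -> Jf A x lam *m stack d delta = newton_map A x lam ->
  l1norm (Jf A x lam *m (stack (x - d) (lam - delta) - stack xs ls))
    <= C * err x lam ^+ 2.
Proof.
have [C C0 CP] := tapply_taylor A 2.
have [_ Axs xs1] := heig.
(* By nonnegativity the entry sum of [xs] is its 1-norm. *)
have sxs : (ones R n)^T *m xs = 1%:M.
  rewrite [LHS]mx11_scalar mxE -xs1; congr (_%:M); apply: eq_bigr => i _.
  by rewrite !mxE mul1r ger0_norm.
exists (C + 1); first lra.
move=> x lam d delta E1 step.
have EP : err x lam = l1norm (x - xs) + `|lam - ls| by exact: l1norm_stackB.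
have ll := normr_ge0 (lam - ls); have lx := l1norm_ge0 (x - xs).
have x2 : l1norm x <= 2.
  by rewrite -(subrK xs x); apply: le_trans (l1normD _ _) _; lra.
have xs2 : l1norm xs <= 2 by lra.
have [QP _] := CP _ _ x2 xs2.
have -> : stack (x - d) (lam - delta) - stack xs ls
   = stack (x - xs) (lam - ls) - stack d delta.
  rewrite /stack !opp_col_mx !add_col_mx -!raddfB.
  by congr (col_mx _ _%:M); rewrite addrAC.
rewrite mulmxBr step Jf_stack /newton_map opp_col_mx add_col_mx l1norm_col_mx.
rewrite [_^T *m _]mulmxBr sxs subrr [X in _ + X]big1 ?addr0; last by move=> i _; rewrite mxE normr0.
rewrite (_ : _ - _ = - (tapply A xs - tapply A x - Tmx A x *m (xs - x))
                     + (lam - ls) *: (x - xs)).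
  apply: le_trans (l1normD _ _) _; rewrite l1normN l1normZ.
  apply: le_trans (lerD QP (lexx _)) _; rewrite EP l1norm_distrC.
  set a := l1norm (x - xs) in lx *; set b := `|lam - ls| in ll *.
  have := mulr_ge0 C0 (mulr_ge0 ll ll); have := mulr_ge0 C0 (mulr_ge0 ll lx).
  have := mulr_ge0 lx lx; have := mulr_ge0 ll lx; have := mulr_ge0 ll ll; lra.
rewrite Axs -[xs - x]opprB mulmxN; apply/colP => i; rewrite !mxE; ring.
Qed.

(** The estimate concerns the multiplier before regularization; the nonsingularity clause, applied
    at the next iterate, then excludes regularization there. *)
Lemma mpni_step_quadratic : nonneg_tensor A -> exists d c : R, [/\ 0 < d, 0 < c &
  forall x lam, err x lam < d -> Jf A x lam \in unitmx /\
  forall x' mu', mpni_step A x lam x' mu' -> err x' mu' <= c * err x lam ^+ 2].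
Proof.
move=> hA; have [d [K [d0 K0 JP]]] := Jf_lbound.
have [C C0 CP] := newton_residual.
have [xs0 Axs xs1] := heig.
(* Read the eigenvalue equation at a positive entry of [xs]. Since [ls] is nonnegative, truncating
   the multiplier at 0 cannot increase its distance to [ls]. *)
have ls0 : 0 <= ls.
  have [i xi] : exists i, 0 < xs i 0.
    apply: contrapT => /forallNP H; move/eqP: xs0; apply.
    apply/colP => i; rewrite mxE; apply/le_anti; rewrite hxs andbT leNgt.
    exact/negP/H.
  rewrite -(pmulr_lge0 _ xi); move/colP/(_ i): Axs; rewrite [RHS]mxE => <-.
  by rewrite mxE sumr_ge0 // => t _; rewrite mulr_ge0 ?hA // prodr_ge0.
(* The factor 2 comes from the projection, [K * C] from inverting the Jacobian on the residual; the
   1 covers [C] = 0. *)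
exists (Num.min d 1), (2 * K * C + 1); split.
- by rewrite lt_min d0 ltr01.
- by rewrite ltr_wpDl // !mulr_ge0 // ltW.
move=> x lam; rewrite lt_min => /andP[Ed E1]; split.
  exact: mulmx_lbound_unit (JP _ _ Ed).
move=> x' mu' [u [v [step -> ->]]].
have := JP _ _ Ed (stack (x - u) (lam - v) - stack xs ls).
have := CP _ _ _ _ E1 step.
set r := l1norm (_ *m _) => rC; rewrite l1norm_stackB => wr.
have Kr : K * r <= K * (C * err x lam ^+ 2) by rewrite ler_pM2l.
have s1 : \sum_i (x - u) i 0 = 1.
  have : (ones R n)^T *m (x - u) = 1%:M.
    move: step; rewrite Jf_stack => /eq_col_mx[_]; rewrite mulmxBr => ->.
    by rewrite opprB addrC subrK.
  move/matrixP/(_ 0 0); rewrite !mxE eqxx mulr1n => <-; apply: eq_bigr => i _.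
  by rewrite !mxE mul1r.
have px := l1norm_simplex_proj hxs xs1 s1.
have pl : `|Num.max (lam - v) 0 - ls| <= `|lam - v - ls|.
  have [//|l0] := leP 0 (lam - v).
  rewrite sub0r normrN ger0_norm // ler0_norm; lra.
rewrite [leLHS]l1norm_stackB.
have E0 : 0 <= err x lam ^+ 2 by rewrite exprn_ge0 ?l1norm_ge0.
have := normr_ge0 (lam - v - ls); lra.
Qed.

End Newton.

(** * Quadratic convergence of the whole sequence *)

Theorem theorem1 (R : realType) (m n : nat) (hm : (2 <= m)%N)
    (A : tensor R m n) (hA : nonneg_tensor A)
    (xs : 'cV[R]_n) (ls : R)
    (hxs : forall i, 0 <= xs i 0)
    (heig : Z1_eigenpair A xs ls)
    (hJ : Jf A xs ls \in unitmx) :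
  exists delta c : R,
    [/\ 0 < delta, 0 < c &
      forall (x : nat -> 'cV[R]_n) (lam : nat -> R), mpni A x lam ->
      forall k0 : nat,
        l1norm (stack (x k0) (lam k0) - stack xs ls) < delta ->
        [/\ x @ \oo --> xs, lam @ \oo --> ls &
          forall k : nat, (k0 <= k)%N ->
            l1norm (stack (x k.+1) (lam k.+1) - stack xs ls)
              <= c * l1norm (stack (x k) (lam k) - stack xs ls) ^+ 2]].
Proof.
have [d [c [d0 c0 H]]] := mpni_step_quadratic heig hJ hxs hA.
(* Below [(2 * c)^-1] the quadratic bound halves the error, so later iterates stay in the
   neighbourhood. *)
exists (Num.min d (2 * c)^-1), c; split=> //.
  by rewrite lt_min d0 invr_gt0 mulr_gt0.
move=> x lam [mu [_ _ reg step]] k0; rewrite lt_min => /andP[Ed0 Ec0].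
pose E k := l1norm (stack (x k) (lam k) - stack xs ls).
have E_ge0 k : 0 <= E k by exact: l1norm_ge0.
have quad k : E k < d -> E k < (2 * c)^-1 ->
    E k.+1 <= c * E k ^+ 2 /\ E k.+1 <= 2^-1 * E k.
  move=> Ed Ec; have [_ /(_ _ _ (step k)) Emu] := H _ _ Ed.
  have half : c * E k ^+ 2 <= 2^-1 * E k.
    rewrite expr2 mulrA ler_wpM2r //.
    by move: Ec; rewrite -div1r ltr_pdivlMr ?mulr_gt0 // => ?; lra.
  (* The Jacobian at the new iterate is nonsingular, so that no
     regularization takes place there. *)
  suff lamE : lam k.+1 = mu k.+1.
    by rewrite /E lamE; split=> //; exact: le_trans half.
  have Emud : l1norm (stack (x k.+1) (mu k.+1) - stack xs ls) < d.
    apply: le_lt_trans Ed; apply: le_trans Emu (le_trans half _).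
    by have := E_ge0 k; lra.
  by have := reg k.+1; rewrite /regularized; have [-> _] := H _ _ Emud.
(* Closeness and geometric decay are proved together, since each halving requires closeness at the
   preceding index. *)
have close j : [/\ E (j + k0)%N < d, E (j + k0)%N < (2 * c)^-1 &
    E (j + k0)%N <= geometric (E k0) 2^-1 j].
  elim: j => [|j [jd jc jg]]; first by rewrite add0n /geometric /= expr0 mulr1.
  have [_ half] := quad _ jd jc; rewrite addSn; have := E_ge0 (j + k0)%N.
  move=> E0; split; [lra|lra|].
  move: jg; rewrite /geometric /= exprS; lra.
have E0 : E k @[k --> \oo] --> 0.
  rewrite -(cvg_shiftn k0); apply: (@squeeze_cvgr _ _ _ _ (fun=> 0) (geometric (E k0) 2^-1)).
  - by apply: nearW => j; rewrite E_ge0 /=; have [] := close j.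
  - exact: cvg_cst.
  - by apply: cvg_geometric; rewrite ger0_norm ?invr_ge0 //; lra.
have EE k : E k = l1norm (x k - xs) + `|lam k - ls| by exact: l1norm_stackB.
split.
- apply: cvg_l1norm; apply: (squeeze_cvgr _ (cvg_cst 0) E0).
  by apply: nearW => k; rewrite l1norm_ge0 EE lerDl /=.
- apply/subr_cvg0/norm_cvg0P; apply: (squeeze_cvgr _ (cvg_cst 0) E0).
  by apply: nearW => k; rewrite normr_ge0 EE lerDr l1norm_ge0.
- move=> k k0k; rewrite -(subnK k0k); have [jd jc _] := close (k - k0)%N.
  by have [] := quad _ jd jc.
Qed.
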